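(* Let $(X,T)$ be a topological space. Then: (i) $(X,T)$ is normal iff $F_1\cap F_2=\emptyset\Rightarrow\mu(F_1)\cap\mu(F_2)=\emptyset$ for any two closed sets $F_1,F_2\subseteq X$. (ii) $(X,T)$ is regular iff $\alpha\notin\mu(x)\Rightarrow\mu(\alpha)\cap\mu(x)=\emptyset$ for any $\alpha\in{}^*X$ and $x\in X$.
   Context: Nonstandard setting. Let $S\supseteq X\cup\mathbb R$ be a set of individuals, with superstructure $V(S)=\bigcup_{k\ge 0}V_k(S)$, $V_0(S)=S$, $V_{k+1}(S)=V_k(S)\cup\mathcal P(V_k(S))$. A $\kappa$-saturated nonstandard model of $S$ is a superstructure $V({}^*S)$ with a map $A\mapsto {}^*A$ from $V(S)$ into $V({}^*S)$ satisfying: (Extension) ${}^*s=s$ for all $s\in S$; (Transfer) a bounded quantifier formula $\Phi(A_1,\dots,A_n)$ with constants in $V(S)$ is true iff $\Phi({}^*A_1,\dots,{}^*A_n)$ is true in $V({}^*S)$; (Saturation) every family of at most $\kappa$ internal sets with the finite intersection property has nonempty intersection. An entity of $V({}^*S)$ is internal if it is an element of ${}^*A$ for some $A\in V(S)$. Throughout, a $\kappa$-saturated model with $\kappa$ infinite and $\kappa>\operatorname{card}T$ is fixed; $X\subseteq {}^*X$. Monads: for $\alpha\in{}^*X$, $\mu(\alpha)=\bigcap\{{}^*G:G\in T,\ \alpha\in{}^*G\}$. For $B\subseteq{}^*X$, $\mu(B)=\bigcap\{{}^*G:G\in T,\ B\subseteq{}^*G\}$. Normal and regular do not include any $T_0$,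 $T_1$ or Hausdorff requirement. *)

(* Defs.v *)
From mathcomp Require Import all_boot all_classical reals topology.

Set Implicit Arguments.
Unset Strict Implicit.
Unset Printing Implicit Defensive.

Local Open Scope classical_set_scope.
Local Open Scope card_scope.

(** * The superstructure over a type of individuals

    Since [V_k(S)] increases with [k], one has [V_{k+1}(S) = S ∪ P(V_k(S))], and
    the elements of [S] are not sets, so this last union is disjoint.  This gives
    a representation of [V_k(S)] by the type [level S k].  An entity of rank at
    most [k] is represented at every level from [k] on; [same] relates the
    representations of one entity, and [superstructure S] is the quotient.
    That this is the cumulative hierarchy [V(S) = ⋃_k V_k(S)] with
    [V_{k+1}(S) = V_k(S) ∪ P(V_k(S))] is the content of [in_V0], [in_VS],
    [in_V_powerset], [in_V_all] and [superstructure_extensionality]. *)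

Fixpoint level (S : Type) (k : nat) : Type :=
  if k is k'.+1 then (S + set (level S k'))%type else S.

Fixpoint same_level (S : Type) (k l : nat) {struct k} :
    level S k -> level S l -> Prop :=
  match k, l return level S k -> level S l -> Prop with
  | 0, 0 => fun x y => x = y
  | 0, l'.+1 => fun x y => y = inl x
  | k'.+1, 0 => fun x y => x = inl y
  | k'.+1, l'.+1 => fun x y =>
      match x, y with
      | inl s, inl t => s = t
      | inr A, inr B =>
          (forall a, A a -> exists2 b, B b & @same_level S k' l' a b) /\
          (forall b, B b -> exists2 a, A a & @same_level S k' l' a b)
      | _, _ => False
      end
  end.

Definition code (S : Type) : Type := {k : nat & level S k}.

Definition same (S : Type) (p q : code S) : Prop :=
  same_level (projT2 p) (projT2 q).

Record superstructure (S : Type) : Type := Entity {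
  codes : set (code S);
  codes_class : exists p, codes = same p }.

Section Superstructure.
Variable S : Type.
Implicit Types (x y : superstructure S) (s t : S) (k : nat).

Definition entity k (a : level S k) : superstructure S :=
  Entity (ex_intro _ (existT (level S) k a) erefl).

Definition vmem x y : Prop :=
  exists k (B : set (level S k)) (b : level S k),
    [/\ y = @entity k.+1 (inr B), B b & x = entity b].

Definition members y : set (superstructure S) := [set x | vmem x y].

Definition indiv s : superstructure S := @entity 0 s.

Definition is_set x : Prop := forall s, x <> indiv s.

Definition in_V k : set (superstructure S) := range (@entity k).

(* The entity of [V_1(S)] whose elements are the individuals in [A]. *)
Definition indset (A : set S) : superstructure S := @entity 1 (inr A).

End Superstructure.

Section SuperstructureTheory.
Variable S : Type.
Implicit Types (x y : superstructure S) (s t : S) (k l m : nat).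

Lemma same_level_refl k (a : level S k) : same_level a a.
Proof.
elim: k a => [//|k IH] [s //|A] /=.
by split=> a Aa; exists a => //; exact: IH.
Qed.

Lemma same_level_sym k l (a : level S k) (b : level S l) :
  same_level a b -> same_level b a.
Proof.
elim: k l a b => [|k IH] [|l] //=.
by move=> [s|A] [t|B] // [AB BA]; split=> [b /BA|a /AB] [c ? ?];
  exists c => //; exact: IH.
Qed.

Lemma same_level_trans k l m (a : level S k) (b : level S l) (c : level S m) :
  same_level a b -> same_level b c -> same_level a c.
Proof.
elim: k l m a b c => [|k IH] [|l] [|m] a b c /=.
- by move=> ->.
- by move=> ->.
- by move=> -> [].
- by move=> ->; case: c => // t ->.
- by move=> -> ->.
- by move=> -> ->; rewrite /=.
- by move: a b => [s|A] [t|B] //= E; case=> F; congr inl; rewrite E.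
- move: a b c => [s|A] [t|B] [u|C] //=; first by move=> ->.
  move=> [AB BA] [BC CB]; split.
  + by move=> a /AB[b /BC[c Cc bc] ab]; exists c => //; exact: IH ab bc.
  + by move=> c /CB[b /BA[a Aa ab] bc]; exists a => //; exact: IH ab bc.
Qed.

(* At a fixed level there is no identification. *)
Lemma same_level_eq k (a b : level S k) : same_level a b -> a = b.
Proof.
elim: k a b => [//|k IH] [s|A] [t|B] //= => [-> //|[AB BA]].
congr inr; apply/seteqP; split=> [a /AB[b Bb /IH -> //]|b /BA[a Aa /IH <- //]].
Qed.

Lemma entity_eq k l (a : level S k) (b : level S l) :
  entity a = entity b <-> same_level a b.
Proof.
split=> [[/(congr1 (fun P => P (existT (level S) l b)))]|ab].
  by rewrite /same /= => ->; exact: same_level_refl.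
have E : same (existT (level S) k a) = same (existT (level S) l b).
  apply/funext => -[m c]; apply/propext; rewrite /same /=; split.
    by apply: same_level_trans; exact: same_level_sym.
  exact: same_level_trans.
rewrite /entity; move: (ex_intro _ _ _) (ex_intro _ _ _); rewrite E => p q.
by congr Entity; exact: Prop_irrelevance.
Qed.

Lemma vmem_entity k (A : set (level S k)) x :
  vmem x (@entity S k.+1 (inr A)) <-> exists2 a, A a & x = entity a.
Proof.
split=> [[l [B [b [/entity_eq/= [_ BA] Bb ->]]]]|[a Aa ->]]; last first.
  by exists k, A, a.
by have [a Aa ab] := BA b Bb; exists a => //; exact/entity_eq/same_level_sym.
Qed.

Lemma indivE k s : indiv s = @entity S k.+1 (inl s).
Proof. exact/entity_eq. Qed.

Lemma indiv_inj : injective (@indiv S).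
Proof. by move=> s t /entity_eq. Qed.

Lemma members_indiv s : members (indiv s) = set0.
Proof.
by apply/seteqP; split=> // x [k [B [b [/entity_eq]]]].
Qed.

Lemma is_setP k (a : level S k.+1) :
  is_set (@entity S k.+1 a) <-> exists A, a = inr A.
Proof.
split=> [|[A ->] s /entity_eq //].
by case: a => [s /(_ s)|A _]; [rewrite (indivE k)|exists A].
Qed.

Lemma members_indset (A : set S) : members (indset A) = @indiv S @` A.
Proof.
apply/seteqP; split=> [x /vmem_entity[a Aa ->]|_ [a Aa <-]].
  by exists a.
by apply/vmem_entity; exists a.
Qed.

Lemma entity_lift k (a : level S k) : exists b : level S k.+1,
  entity a = entity b.
Proof.
elim: k a => [a|k IH [s|A]]; first by exists (inl a); exact: indivE.
  by exists (inl s); rewrite -!indivE.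
exists (inr [set b : level S k.+1 |
  exists2 a : level S k, A a & same_level a b]).
apply/entity_eq; split=> [a Aa|b [a Aa ab]]; last by exists a.
by have [b /entity_eq ab] := IH a; exists b => //; exists a.
Qed.

Lemma superstructure_extensionality x y :
  is_set x -> is_set y -> members x = members y -> x = y.
Proof.
have H z : exists k (a : level S k.+1), z = entity a.
  case: z => C [[k a] E]; have [b ab] := entity_lift a.
  exists k, b; rewrite -ab /entity; subst C.
  by congr Entity; exact: Prop_irrelevance.
have [k [a ->]] := H x; have [l [b ->]] := H y.
move=> /is_setP[A ->] /is_setP[B ->] AB; apply/entity_eq; split=> [c Ac|c Bc].
  have : members (@entity S k.+1 (inr A)) (entity c).
    by apply/vmem_entity; exists c.
  by rewrite AB => /vmem_entity[d Bd /entity_eq]; exists d.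
have : members (@entity S l.+1 (inr B)) (entity c).
  by apply/vmem_entity; exists c.
by rewrite -AB => /vmem_entity[d Ad /entity_eq/same_level_sym]; exists d.
Qed.

Lemma in_V0 : in_V 0 = range (@indiv S).
Proof. by []. Qed.

Lemma in_V_powerset k (P : set (superstructure S)) : P `<=` in_V k ->
  exists x, [/\ in_V k.+1 x, is_set x & members x = P].
Proof.
move=> Pk; exists (@entity S k.+1 (inr [set a | P (entity a)])); split.
- by exists (inr [set a | P (entity a)]).
- by apply/is_setP; exists [set a | P (entity a)].
- apply/seteqP; split=> [x /vmem_entity[a Pa -> //]|x Px].
  have [a _ ax] := Pk x Px; apply/vmem_entity.
  by exists a => //=; rewrite ax.
Qed.

Lemma in_VS k :
  in_V k.+1 = in_V k `|` [set x | is_set x /\ members x `<=` @in_V S k].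
Proof.
apply/seteqP; split=> [_ [[s|A] _ <-]|x [[a _ <-]|[xS xk]]].
- left; elim: k => [|k [a _ ak]]; first by exists s => //; rewrite -indivE.
  by exists (inl s) => //; rewrite -!indivE.
- right; split=> [|y /vmem_entity[a _ ->]]; last by exists a.
  by apply/is_setP; exists A.
- by have [b ab] := entity_lift a; exists b.
- have [y [yk yS yx]] := in_V_powerset xk.
  by rewrite (superstructure_extensionality xS yS (esym yx)).
Qed.

Lemma in_V_all x : exists k, in_V k x.
Proof.
case: x => C [[k a] E]; exists k, a => //; subst C; rewrite /entity.
by congr Entity; exact: Prop_irrelevance.
Qed.

End SuperstructureTheory.

(** * Bounded quantifier formulas

    De Bruijn indices: [BAll i f] reads "for all x in v_i, f", where x is
    variable 0 in [f] and the former variable [n] becomes [n.+1].  Constants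
    are the values that the environment gives to the free variables. *)

Inductive bformula : Type :=
  | BEq of nat & nat
  | BMem of nat & nat
  | BNot of bformula
  | BAnd of bformula & bformula
  | BOr of bformula & bformula
  | BImp of bformula & bformula
  | BAll of nat & bformula
  | BEx of nat & bformula.

Definition push (T : Type) (x : T) (e : nat -> T) : nat -> T :=
  fun n => if n is m.+1 then e m else x.

Fixpoint holds (S : Type) (e : nat -> superstructure S) (f : bformula) : Prop :=
  match f with
  | BEq i j => e i = e j
  | BMem i j => vmem (e i) (e j)
  | BNot f1 => ~ holds e f1
  | BAnd f1 f2 => holds e f1 /\ holds e f2
  | BOr f1 f2 => holds e f1 \/ holds e f2
  | BImp f1 f2 => holds e f1 -> holds e f2
  | BAll i f1 => forall x, vmem x (e i) -> holds (push x e) f1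
  | BEx i f1 => exists2 x, vmem x (e i) & holds (push x e) f1
  end.

(** * Saturated nonstandard models *)

Definition internal (S S' : Type)
    (star : superstructure S -> superstructure S') :
    set (superstructure S') :=
  [set B | exists A, vmem B (star A)].

(* The cardinal kappa is the cardinality of the type [K].  The inclusion of [S]
   in *S is the injection [incl], so that "*s = s for s in S" becomes
   [star_indiv].  [star_individuals] says that the superstructure V( *S ) is
   built on the image *S of the set [S]. *)
Record saturated_model (S K : Type) : Type := SaturatedModel {
  nsS : Type;
  incl : S -> nsS;
  star : superstructure S -> superstructure nsS;
  incl_inj : injective incl;
  star_individuals : star (indset [set: S]) = indset [set: nsS];
  star_indiv : forall s, star (indiv s) = indiv (incl s);
  transfer : forall (f : bformula) (e : nat -> superstructure S),
    holds e f <-> holds (star \o e) f;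
  saturation : forall F : set (superstructure nsS),
    F #<= [set: K] ->
    (forall A, F A -> is_set A /\ internal star A) ->
    (forall F', finite_set F' -> F' `<=` F ->
      \bigcap_(A in F') members A !=set0) ->
    \bigcap_(A in F) members A !=set0 }.

Definition card_lt (T U : Type) (A : set T) (B : set U) : Prop :=
  A #<= B /\ ~ (B #<= A).

(** * Monads *)

Section Monads.
Variables (S K : Type) (M : saturated_model S K).
Variables (X : topologicalType) (j : X -> S).

(* The set of the elements of *A. *)
Definition nsext (A : set X) : set (superstructure (nsS M)) :=
  members (star M (indset (j @` A))).

Definition nspoint (x : X) : superstructure (nsS M) := indiv (incl M (j x)).

(* The monad of a point [x] of [X] is [monad (nspoint x)]. *)
Definition monad (alpha : superstructure (nsS M)) :
    set (superstructure (nsS M)) :=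
  \bigcap_(G in [set G : set X | open G /\ nsext G alpha]) nsext G.

Definition monad_set (B : set (superstructure (nsS M))) :
    set (superstructure (nsS M)) :=
  \bigcap_(G in [set G : set X | open G /\ B `<=` nsext G]) nsext G.

End Monads.

Arguments nsext {S K} M {X} j A.
Arguments nspoint {S K} M {X} j x.
Arguments monad {S K} M {X} j alpha.
Arguments monad_set {S K} M {X} j B.

(* Main.v *)
Require Import Defs.
From mathcomp Require Import all_boot all_classical reals topology.
From mathcomp Require Import finmap urysohn.

(** Transfer makes [A |-> *A] a Boolean homomorphism, so disjoint open sets give
    disjoint monads; saturation gives a common point of the *A for [kappa] many
    members A of a proper filter.  If two closed sets are not separated, the
    intersections of their neighbourhoods generate such a filter, and the common
    point lies in both monads.  If regularity fails at [x] for a closed set F,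
    saturating the sets F `&` closure U, with U an open neighbourhood of [x],
    gives alpha in *F outside the monad of [x]; every open H with alpha in *H
    meets every such U, so the monads of alpha and [x] have a common point. *)

Set Implicit Arguments.
Unset Strict Implicit.
Unset Printing Implicit Defensive.

Local Open Scope classical_set_scope.
Local Open Scope card_scope.

(** * Consequences of transfer for arbitrary entities *)

Section NonstandardExtension.
Variables (S K : Type) (M : saturated_model S K).
Implicit Types A B C : superstructure S.

Definition env3 {T : Type} (a b c : T) : nat -> T := push a (push b (fun=> c)).

Lemma star_subI A B C : members A `&` members B `<=` members C ->
  members (star M A) `&` members (star M B) `<=` members (star M C).
Proof.
move=> ABC.
(* Under the quantifier the indices shift by one: 0 is the bound element, while [A], [B], [C] become
   1, 2, 3. *)
have /(transfer M) H : holds (env3 A B C) (BAll 0 (BImp (BMem 0 2) (BMem 0 3))).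
  by move=> x Ax Bx; exact: ABC.
by move=> x [Ax Bx]; exact: H Ax Bx.
Qed.

Lemma star_subU A B C : members A `<=` members B `|` members C ->
  members (star M A) `<=` members (star M B) `|` members (star M C).
Proof.
move=> ABC.
have /(transfer M) H : holds (env3 A B C) (BAll 0 (BOr (BMem 0 2) (BMem 0 3))).
  by move=> x Ax; exact: ABC.
by move=> x Ax; exact: H Ax.
Qed.

Lemma star_vmem A B : vmem (star M A) (star M B) <-> vmem A B.
Proof. exact: iff_sym (transfer M (BMem 0 1) (env3 A B B)). Qed.

Lemma star_nonempty A : members A !=set0 -> members (star M A) !=set0.
Proof.
move=> [a Aa].
(* The body [BEq 0 0] is always true, so the formula expresses only that [A] has an element. *)
have /(transfer M) H : holds (env3 A A A) (BEx 0 (BEq 0 0)) by exists a.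
by case: H => x Ax _; exists x.
Qed.

Lemma star_empty A : members A = set0 -> members (star M A) = set0.
Proof.
move=> A0; apply/seteqP; split=> // x Ax.
have /(transfer M) H : holds (env3 A A A) (BAll 0 (BNot (BEq 0 0))).
  by move=> y; rewrite -[vmem _ _]/(members A y) A0.
exact: H Ax erefl.
Qed.

(* Since [star (indset setT)] is the set of all nonstandard individuals, being
   a set is the transfer of not belonging to [indset setT]. *)
Lemma star_is_set A : is_set A -> is_set (star M A).
Proof.
move=> As s sE.
have : members (star M (indset setT)) (star M A).
  by rewrite star_individuals members_indset; exists s.
move=> /star_vmem; rewrite -[vmem _ _]/(members _ _) members_indset.
by case=> t _ /esym; exact: As.
Qed.

Lemma star_internal A : internal (star M) (star M A).
Proof.
have [k kA] := in_V_all A.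
(* The singleton of [A] is an entity one level higher; its star has the star of [A] as an
   element. *)
have [|B [_ _ BA]] := @in_V_powerset S k [set A]; first by move=> _ ->.
by exists B; apply/star_vmem; rewrite -[vmem _ _]/(members _ _) BA.
Qed.

End NonstandardExtension.

(** * Extensions of subsets of the space, and saturation along filters *)

Section SpaceExtension.
Variables (S K : Type) (M : saturated_model S K).
Variables (X : topologicalType) (jX : X -> S).
Implicit Types (A B C G : set X) (alpha : superstructure (nsS M)).

Local Notation "*[ A ]" := (nsext M jX A) (format "*[ A ]").

Lemma members_indset_image A :
  members (indset (jX @` A)) = (@indiv S \o jX) @` A.
Proof. by rewrite members_indset image_comp. Qed.

Lemma nsextS A B : A `<=` B -> *[A] `<=` *[B].
Proof.
move=> AB alpha.
case/(star_subU (B := indset (jX @` B)) (C := indset (jX @` B))) => //.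
by rewrite !members_indset_image setUid; exact: image_subset.
Qed.

Lemma nsextN0 A : A !=set0 -> *[A] !=set0.
Proof.
move=> A0; apply: star_nonempty.
by rewrite members_indset_image; exact: image_nonempty.
Qed.

Lemma nsext0 : *[set0] = set0.
Proof. by apply: star_empty; rewrite members_indset_image image_set0. Qed.

Lemma nsextUC A alpha : *[setT] alpha -> *[A] alpha \/ *[~` A] alpha.
Proof.
apply: star_subU; rewrite !members_indset_image -image_setU setUv.
exact: subset_refl.
Qed.

Hypothesis jX_inj : injective jX.

(** Injectivity of [jX] makes the image of [A] and the image of [B] meet only in images of common
    points; transfer does the rest. *)
Lemma nsextI A B : *[A] `&` *[B] `<=` *[A `&` B].
Proof.
apply: star_subI; rewrite !members_indset_image.
move=> _ [[a Aa <-] [b Bb ba]].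
by exists a => //; split=> //; rewrite -(jX_inj (indiv_inj ba)).
Qed.

Lemma nsext_disjoint A B : A `&` B = set0 -> *[A] `&` *[B] = set0.
Proof.
by move=> AB0; rewrite -subset0 -nsext0 -AB0; exact: nsextI.
Qed.

Lemma nsext_point A x : *[A] (nspoint M jX x) <-> A x.
Proof.
rewrite /nspoint -star_indiv; apply: (iff_trans (star_vmem M _ _)).
rewrite -[vmem _ _]/(members _ _) members_indset_image.
split=> [[y Ay yx]|Ax]; last by exists x.
by rewrite -(jX_inj (indiv_inj yx)).
Qed.

Lemma nsext_points A B : nspoint M jX @` A `<=` *[B] <-> A `<=` B.
Proof.
split=> [AB x Ax|AB _ [x Ax <-]]; last exact/nsext_point/AB.
by apply/nsext_point/AB; exists x.
Qed.

(** A finite intersection of sets [f i] belongs to the proper filter, hence is nonempty, and so is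
    its extension: this is the finite intersection property. *)
Lemma filter_saturation {I : choiceType} (F : set_system X) (D : set I)
    (f : I -> set X) : ProperFilter F -> D #<= [set: K] ->
  (forall i, D i -> F (f i)) -> exists alpha, forall i, D i -> *[f i] alpha.
Proof.
move=> FF DK DF.
pose g i := star M (indset (jX @` f i)).
have [||F' F'fin F'D|alpha Halpha] := @saturation _ _ M (g @` D).
- exact: card_le_trans (card_image_le _ _) DK.
- move=> _ [i _ <-]; split; last exact: star_internal.
  by apply: star_is_set; apply/is_setP; eexists.
(* Saturation concerns a set of entities, so an index must be chosen for each member of [F']; [None]
   is the default elsewhere, as [I] may be empty. *)
- have [h hP] : exists h : superstructure (nsS M) -> option I,
      forall Y, F' Y -> exists2 i, h Y = Some i & D i /\ g i = Y.
    suff /choice[h hP] : forall Y, exists o : option I,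
        F' Y -> exists2 i, o = Some i & D i /\ g i = Y by exists h.
    move=> Y; have [/F'D[i Di giY]|nY] := pselect (F' Y); last by exists None.
    by exists (Some i) => _; exists i.
  pose f' (o : option I) := if o is Some i then f i else setT.
  have /finite_fsetP[E hE] : finite_set (h @` F') by exact: finite_image.
  have FE : F (\bigcap_(o in [set` E]) f' o).
    apply: filter_bigI => o oE.
    have : [set` E] o by [].
    by rewrite -hE => -[Y /hP[i -> [Di _]] <-]; exact: DF.
  have [alpha aE] := nsextN0 (filter_ex FE).
  exists alpha => Y F'Y; have [i hY [Di <-]] := hP Y F'Y.
  apply: nsextS aE => y; apply: (_ : _ `<=` f' (Some i)).
  by apply: bigcap_inf; rewrite -hE -hY; exists Y.
- by exists alpha => i Di; apply: Halpha; exists i.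
Qed.

(** * Separation by open sets versus disjointness of monads *)

Hypothesis openK : [set G : set X | open G] #<= [set: K].

Lemma open_card_le (D : set (set X)) : D `<=` open -> D #<= [set: K].
Proof. by move=> Do; exact: card_le_trans (subset_card_le Do) openK. Qed.

Lemma monads_separatedP F1 F2 :
  monad_set M jX (nspoint M jX @` F1) `&` monad_set M jX (nspoint M jX @` F2)
    = set0 <->
  exists U V, [/\ open U, open V, F1 `<=` U, F2 `<=` V & U `&` V = set0].
Proof.
split=> [mu0|[U [V [oU oV F1U F2V UV0]]]]; last first.
  rewrite -subset0 -(nsext_disjoint UV0) => alpha [a1 a2].
  by split; [apply: a1|apply: a2]; split=> //; exact/nsext_points.
apply: contrapT => nsep.
pose D : set (set X * set X) :=
  [set p | [/\ open p.1, open p.2, F1 `<=` p.1 & F2 `<=` p.2]].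
pose N := filter_from D (fun p => p.1 `&` p.2).
have NF : ProperFilter N.
  apply: filter_from_proper; first apply: filter_from_filter.
  - by exists (setT, setT); split=> //; exact: openT.
  - move=> [U V] [U' V'] [/= oU oV F1U F2V] [/= oU' oV' F1U' F2V'].
    exists (U `&` U', V `&` V'); last by move=> x [/= [? ?] [? ?]].
    by split=> /=; [exact: openI|exact: openI|rewrite subsetI|rewrite subsetI].
  - move=> [U V] [/= oU oV F1U F2V]; apply/set0P/eqP => UV0.
    by apply: nsep; exists U, V.
(* The family is indexed by single open sets rather than by pairs, so that [openK] bounds its
   cardinality directly. *)
have [|G [oG [F1G|F2G]]|alpha Ha] :=
    filter_saturation (f := id) NF
      (D := [set G | open G /\ (F1 `<=` G \/ F2 `<=` G)]).
- by apply: open_card_le => G [].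
- by exists (G, setT); [split=> //; exact: openT|move=> x []].
- by exists (setT, G); [split=> //; exact: openT|move=> x []].
rewrite -[False]/((set0 : set (superstructure (nsS M))) alpha) -mu0.
by split=> G [oG /nsext_points FG]; apply: Ha; split=> //; [left|right].
Qed.

Lemma monad_pointP x alpha : monad M jX (nspoint M jX x) alpha <->
  forall G, open G -> G x -> *[G] alpha.
Proof.
split=> [mua G oG Gx|H G [oG /nsext_point Gx]]; last exact: H.
by apply: mua; split=> //; exact/nsext_point.
Qed.

Lemma regular_monad_disjoint x alpha : {for x, regular_space X} ->
  *[setT] alpha -> ~ monad M jX (nspoint M jX x) alpha ->
  monad M jX alpha `&` monad M jX (nspoint M jX x) = set0.
Proof.
move=> /regular_openP regx aX nmua.
have [G [oG Gx nGa]] : exists G, [/\ open G, G x & ~ *[G] alpha].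
  apply: contrapT => nG; apply: nmua; apply/monad_pointP => G oG Gx.
  by apply: contrapT => nGa; apply: nG; exists G.
have [//|U [V [oU oV Ux GV UV0]]] := regx (~` G) (open_closedC oG).
have [//|/(nsextS GV) Va] := nsextUC G aX.
rewrite -subset0 -(nsext_disjoint UV0) => beta [b1 /monad_pointP b2].
by split; [exact: b2|exact: b1].
Qed.

Lemma monad_disjoint_regular x :
  (forall alpha, *[setT] alpha -> ~ monad M jX (nspoint M jX x) alpha ->
    monad M jX alpha `&` monad M jX (nspoint M jX x) = set0) ->
  {for x, regular_space X}.
Proof.
move=> mu0; apply/regular_openP => F cF nFx; apply: contrapT => nsep.
pose D : set (set X) := [set U | open U /\ U x].
have DT : D setT by split=> //; exact: openT.
have DI U V : D U -> D V -> D (U `&` V).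
  by move=> [oU Ux] [oV Vx]; split=> //; exact: openI.
pose N := filter_from D (fun U => F `&` closure U).
have NF : ProperFilter N.
  apply: filter_from_proper; first apply: filter_from_filter.
  - by exists setT.
  - move=> U V DU DV; exists (U `&` V); first exact: DI.
    by move=> y [Fy /closureI[? ?]].
  - move=> U [oU Ux]; apply/set0P/eqP => FU0.
    apply: nsep; exists U, (~` closure U); split=> //.
    + exact/closed_openC/closed_closure.
    + by apply/disjoints_subset.
    + by apply/disjoints_subset; rewrite setCK; exact: subset_closure.
have [|U DU|alpha Ha] :=
    filter_saturation (f := fun U => F `&` closure U) NF (D := D).
- by apply: open_card_le => U [].
- by exists U.
have aF : *[F] alpha by apply: nsextS (Ha _ DT) => y [].
have nmua : ~ monad M jX (nspoint M jX x) alpha.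
  move=> /monad_pointP/(_ (~` F) (closed_openC cF) nFx) aFC.
  have : ( *[F] `&` *[~` F]) alpha by [].
  by rewrite nsext_disjoint// setICr.
(* Second saturation: a point of the extensions of all sets in [E] and [D] lies in both monads. *)
pose E : set (set X) := [set H | open H /\ *[H] alpha].
pose L := filter_from (E `*` D) (fun p => p.1 `&` p.2).
have LF : ProperFilter L.
  apply: filter_from_proper; first apply: filter_from_filter.
  - by exists (setT, setT); do 2!split=> //; [exact: openT|exact: nsextS aF].
  - move=> [H U] [H' U'] [/= [oH aH] DU] [/= [oH' aH'] DU'].
    exists (H `&` H', U `&` U'); last by move=> y [/= [? ?] [? ?]].
    by split=> /=; [split; [exact: openI|exact: nsextI]|exact: DI].
  - move=> [H U] [/= [oH aH] DU]; apply/set0P/eqP => HU0.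
    have /disjoints_subset clU : closure U `&` H = set0.
      apply/disjoints_subset; rewrite closureE; apply: smallest_sub.
        exact: open_closedC.
      by apply/disjoints_subset; rewrite setIC.
    have : ( *[H] `&` *[F `&` closure U]) alpha by split=> //; exact: Ha.
    rewrite nsext_disjoint// setIC; apply/disjoints_subset.
    by move=> y [_ /clU].
have [|G [EG|DG]|beta Hb] := filter_saturation (f := id) LF (D := E `|` D).
- by apply: open_card_le => U [] [].
- by exists (G, setT); [split|move=> y []].
- exists (setT, G); [split=> //|by move=> y []].
  by split; [exact: openT|exact: nsextS aF].
rewrite -[False]/((set0 : set (superstructure (nsS M))) beta).
rewrite -(mu0 alpha) //; last exact: nsextS aF.
split=> [G EG|]; first by apply: Hb; left.
by apply/monad_pointP => G oG Gx; apply: Hb; right.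
Qed.

End SpaceExtension.

Theorem mainTheorem11
    (X : topologicalType) (R : realType) (S : Type)
    (jX : X -> S) (jR : R -> S)
    (jX_inj : injective jX) (jR_inj : injective jR)
    (K : Type) (K_infinite : infinite_set [set: K])
    (K_gt : card_lt [set G : set X | open G] [set: K])
    (M : saturated_model S K) :
  (normal_space X <->
     forall F1 F2 : set X, closed F1 -> closed F2 ->
       F1 `&` F2 = set0 ->
       monad_set M jX (nspoint M jX @` F1)
         `&` monad_set M jX (nspoint M jX @` F2) = set0) /\
  (regular_space X <->
     forall (alpha : superstructure (nsS M)) (x : X),
       nsext M jX [set: X] alpha ->
       ~ monad M jX (nspoint M jX x) alpha ->
       monad M jX alpha `&` monad M jX (nspoint M jX x) = set0).
Proof.
have openK := K_gt.1; split; split.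
(* [normal_openP] turns normality into separation by disjoint open sets, the right-hand side of
   [monads_separatedP]. *)
- move=> /(@normal_openP R) nX F1 F2 cF1 cF2 F120.
  exact/monads_separatedP/nX.
- move=> mu0; apply/(@normal_openP R) => F1 F2 cF1 cF2 F120.
  by apply/(monads_separatedP M jX_inj openK); exact: mu0.
- by move=> rX alpha x; apply: regular_monad_disjoint => //; exact: rX.
- move=> mu0 x; apply: (monad_disjoint_regular jX_inj openK (M := M)) => alpha.
  exact: mu0.
Qed.
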